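(* Let $n,k,t$ be integers with $1\leq t\leq k-2$ and $$\max\left\{\binom{t+2}{2},\ \frac{k-t+2}{2}\right\}\cdot(k-t+1)^2+t\leq n.$$ If $\mathcal{F}\subseteq\binom{[n]}{k}$ is a maximal non-trivial $t$-intersecting family with $$|\mathcal{F}|\geq (k-t)\binom{n-t-1}{k-t-1}-\binom{k-t}{2}\binom{n-t-2}{k-t-2},$$ then one of the following holds: (i) $\mathcal{F}=\mathcal{H}_1(X,M,C)$ for some $t$-subset $X$, $k$-subset $M$ and $c$-subset $C$ of $[n]$ with $X\subseteq M\subseteq C$, where $c\in\{k+1,k+2,\ldots,2k-t,n\}$; (ii) $\mathcal{F}=\mathcal{H}_2(Z)$ for some $(t+2)$-subset $Z$ of $[n]$, and $\frac{k}{2}-1\leq t\leq k-2$.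
   Context: $[n]=\{1,\ldots,n\}$ and $\binom{[n]}{k}$ is the family of all $k$-subsets of $[n]$. A family $\mathcal{F}\subseteq\binom{[n]}{k}$ is $t$-intersecting if $|A\cap B|\geq t$ for all $A,B\in\mathcal{F}$; it is trivial if all its members contain a common $t$-subset of $[n]$, and non-trivial otherwise. ''Maximal'' means maximal with respect to inclusion among $t$-intersecting subfamilies of $\binom{[n]}{k}$. Family I: for subsets $X\subseteq M\subseteq C\subseteq[n]$ with $|X|=t$, $|M|=k$, $|C|=c$, where $c\in\{k+1,\ldots,2k-t,n\}$ (so $C=[n]$ when $c=n$), $\mathcal{H}_1(X,M,C)=\mathcal{A}(X,M)\cup\mathcal{B}(X,M,C)\cup\mathcal{C}(X,M,C)$ where $\mathcal{A}(X,M)=\{F\in\binom{[n]}{k}: X\subseteq F,\ |F\cap M|\geq t+1\}$, $\mathcal{B}(X,M,C)=\{F\in\binom{[n]}{k}: F\cap M=X,\ |F\cap C|=c-k+t\}$, $\mathcal{C}(X,M,C)=\{F\in\binom{C}{k}: |F\cap X|=t-1,\ |F\cap M|=k-1\}$. Family II: for a $(t+2)$-subset $Z$ of $[n]$, $\mathcal{H}_2(Z)=\{F\in\binom{[n]}{k}: |F\cap Z|\geq t+1\}$. *)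

(* Defs.v *)
From mathcomp Require Import all_boot all_order all_algebra.

Set Implicit Arguments.
Unset Strict Implicit.
Unset Printing Implicit Defensive.

(* The ground set [n] is 'I_n, i.e. {0, ..., n-1}. *)

Definition ksubsets (n k : nat) : {set {set 'I_n}} :=
  [set F : {set 'I_n} | #|F| == k].

Definition t_intersecting (n t : nat) (F : {set {set 'I_n}}) : bool :=
  [forall A in F, forall B in F, t <= #|A :&: B|].

Definition trivial_family (n t : nat) (F : {set {set 'I_n}}) : bool :=
  [exists T : {set 'I_n}, (#|T| == t) && [forall A in F, T \subset A]].

Definition maximal_t_intersecting (n k t : nat) (F : {set {set 'I_n}}) : bool :=
  maxset (fun G : {set {set 'I_n}} =>
            (G \subset ksubsets n k) && t_intersecting t G) F.

Definition famA (n k t : nat) (X M : {set 'I_n}) : {set {set 'I_n}} :=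
  [set F in ksubsets n k | (X \subset F) && (t + 1 <= #|F :&: M|)].

(* Only used with k <= c, so that c - k is not truncated. *)
Definition famB (n k t c : nat) (X M C : {set 'I_n}) : {set {set 'I_n}} :=
  [set F in ksubsets n k | (F :&: M == X) && (#|F :&: C| == c - k + t)].

(* Only used with 1 <= t and 1 <= k. *)
Definition famC (n k t : nat) (X M C : {set 'I_n}) : {set {set 'I_n}} :=
  [set F in ksubsets n k |
     [&& F \subset C, #|F :&: X| == t - 1 & #|F :&: M| == k - 1]].

Definition H1 (n k t c : nat) (X M C : {set 'I_n}) : {set {set 'I_n}} :=
  famA k t X M :|: famB k t c X M C :|: famC k t X M C.

Definition H2 (n k t : nat) (Z : {set 'I_n}) : {set {set 'I_n}} :=
  [set F in ksubsets n k | t + 1 <= #|F :&: Z|].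

(* Main.v *)
(* Call T a t-cover of F if it meets every member of F in at least t points, and
   put s = k - t. If S is not a t-cover, some B in F has |S :&: B| < t, and every
   member of F containing S hits any fixed s + 1 points of B outside S; hence at
   most s + 1 times as many members contain S as contain S + y, for the best point
   y. Applied to a t-cover of minimal size, this shows that a
   large F has a t-cover of size t + 1, and in fact at least two.

   Maximality puts every k-superset of a t-cover into F, so the t-covers of size
   t + 1 pairwise meet in t points. Either they are not all through a common
   t-set, and three of them are of the form Z minus a point with |Z| = t + 2,
   which forces F = H2(Z); or they are the sets X + x for x in a set L. If
   |L| < s, splitting F according to whether A contains X and meets L gives too
   small a bound on |F|. If |L| >= s, choose M with X <= M <= X + L and |M| = k: a
   member avoiding a point of X is M - x + y, and a member meeting M exactly in X
   contains all the y that occur, which forces F = H1(X, M, C) with C = M + {y},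
   or C = [n] when there is no member of the second kind. *)

Require Import Defs.
From mathcomp Require Import all_boot all_order all_algebra.
From mathcomp Require Import zify ring lra.

Set Implicit Arguments.
Unset Strict Implicit.
Unset Printing Implicit Defensive.

Import Order.TTheory GRing.Theory Num.Theory.

(** * Union bounds and stars of uniform families *)

Lemma card_le_indexed_cover (I T : finType) (W : {set I}) (G : {set T})
    (H : I -> {set T}) (m : nat) :
    (forall A, A \in G -> exists2 y, y \in W & A \in H y) ->
    (forall y, y \in W -> #|H y| <= m) ->
  #|G| <= #|W| * m.
Proof.
move=> GH Hm; apply: (@leq_trans #|\bigcup_(y in W) H y|).
  by apply/subset_leq_card/subsetP => A /GH[y Wy Hy]; apply/bigcupP; exists y.
apply: (@leq_trans (\sum_(y in W) #|H y|)).
  elim/big_rec2: _ => [|y p B _ le_Bp]; first by rewrite cards0.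
  by rewrite (leq_trans (leq_card_setU _ _)) // leq_add2l.
by rewrite -sum_nat_const; apply: leq_sum => y /Hm.
Qed.

Lemma exists_subset_card (T : finType) (B : {set T}) (j : nat) :
  j <= #|B| -> exists2 W : {set T}, W \subset B & #|W| = j.
Proof.
rewrite -bin_gt0 -cards_draws => /card_gt0P[W].
by rewrite inE => /andP[WB /eqP Wj]; exists W.
Qed.

Lemma card_uniform_star (T : finType) (G : {set {set T}}) (S : {set T}) (k : nat) :
    (forall A, A \in G -> S \subset A /\ #|A| = k) ->
  #|G| <= 'C(#|T| - #|S|, k - #|S|).
Proof.
move=> GS; have -> : #|T| - #|S| = #|~: S| by rewrite -(cardsC S) addKn.
have injD : {in G &, injective (fun A => A :\: S)}.
  move=> A B /GS[/setIidPr AS _] /GS[/setIidPr BS _] eqAB.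
  by rewrite -(setID A S) -(setID B S) AS BS eqAB.
rewrite -cards_draws -(card_in_imset injD); apply/subset_leq_card/subsetP => _ /imsetP[A GA ->].
have [SA Ak] := GS A GA.
by rewrite inE cardsDS // Ak eqxx andbT subsetDr.
Qed.

(** * Covers of a [t]-intersecting family *)

Section Intersecting.

Variables (V : finType) (k t : nat) (F : {set {set V}}).

Definition t_cover (T : {set V}) := [forall A in F, t <= #|T :&: A|].

Definition star (S : {set V}) := [set A in F | S \subset A].

Hypothesis cardF : forall A, A \in F -> #|A| = k.
Hypothesis intF : forall A B, A \in F -> B \in F -> t <= #|A :&: B|.
Hypothesis maxF : forall A : {set V}, #|A| = k ->
  (forall B, B \in F -> t <= #|A :&: B|) -> A \in F.

Lemma t_coverP (T : {set V}) :
  reflect (forall A, A \in F -> t <= #|T :&: A|) (t_cover T).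
Proof. by apply: (iffP forall_inP). Qed.

Lemma not_t_coverP (T : {set V}) :
  reflect (exists2 A, A \in F & #|T :&: A| < t) (~~ t_cover T).
Proof.
rewrite negb_forall_in; apply: (iffP exists_inP) => -[A FA TA]; exists A => //.
  by rewrite ltnNge.
by rewrite -ltnNge.
Qed.

Lemma card_star (S : {set V}) : #|star S| <= 'C(#|V| - #|S|, k - #|S|).
Proof.
apply: card_uniform_star => A.
by rewrite inE => /andP[/cardF].
Qed.

(* A member of [star S] meets every subset of [B :\: S] of size [k - t + 1],
   since it misses at most [k - t] points of [B]. *)
Lemma star_step (S B : {set V}) (m : nat) : t <= k -> B \in F ->
    #|S :&: B| < t -> (forall y, y \notin S -> #|star (y |: S)| <= m) ->
  #|star S| <= (k - t + 1) * m.
Proof.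
move=> le_tk FB ltSB bnd; have cB := cardF FB.
have [|W WB cW] := @exists_subset_card _ (B :\: S) (k - t + 1).
  by have := cardsID S B; rewrite setIC; lia.
rewrite -cW; apply: (card_le_indexed_cover (H := fun y => star (y |: S))) => [A|y Wy].
  rewrite inE => /andP[FA SA].
  case: (set_0Vmem (A :&: W)) => [AW0|[y]]; last first.
    by rewrite inE => /andP[Ay Wy]; exists y => //; rewrite inE FA subUset sub1set Ay.
  have : A :&: B \subset B :\: W.
    apply/subsetP => y; rewrite !inE => /andP[Ay ->]; rewrite andbT.
    by apply/negP => Wy; move/setP/(_ y): AW0; rewrite !inE Ay Wy.
  move/subset_leq_card; have := intF FA FB.
  rewrite cardsDS ?cW ?cB; last by apply: subset_trans WB (subsetDl _ _).
  by lia.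
by apply: bnd; move/subsetP/(_ y Wy): WB; rewrite inE => /andP[].
Qed.

(** Sets with fewer than [tau] points are not covers, so [star_step] can be applied [m] times,
    adding one point each time, until the trivial star bound at size [tau] takes over. *)
Lemma card_star_below (tau m : nat) (S : {set V}) : t <= k ->
    (forall S : {set V}, #|S| < tau -> ~~ t_cover S) -> #|S| + m = tau ->
  #|star S| <= (k - t + 1) ^ m * 'C(#|V| - tau, k - tau).
Proof.
move=> le_tk small; elim: m S => [|m IHm] S.
  by rewrite addn0 expn0 mul1n => <-; apply: card_star.
move=> Stau; have /not_t_coverP[B FB ltSB] : ~~ t_cover S by apply: small; lia.
rewrite expnS -mulnA; apply: (star_step le_tk FB ltSB) => y yS.
by apply: IHm; rewrite cardsU1 yS; lia.
Qed.

Lemma card_noncover_star (S : {set V}) : t <= k ->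
    #|S| = t + 1 -> ~~ t_cover S ->
  #|star S| <= (k - t + 1) * 'C(#|V| - t - 2, k - t - 2).
Proof.
move=> le_tk cS /not_t_coverP[B FB ltSB].
apply: (star_step le_tk FB ltSB) => y yS; apply: leq_trans (card_star _) _.
by rewrite cardsU1 yS cS -!subnDA (_ : true + (t + 1) = t + 2); last lia.
Qed.

(** Every member contains one of the [t]-subsets of [T], and each of their stars is bounded by
    [card_star_below] with [m = #|T| - t]. *)
Lemma card_min_cover (T : {set V}) : t <= k -> t_cover T ->
    (forall S : {set V}, #|S| < #|T| -> ~~ t_cover S) ->
  #|F| <= 'C(#|T|, t) * ((k - t + 1) ^ (#|T| - t) * 'C(#|V| - #|T|, k - #|T|)).
Proof.
move=> le_tk /t_coverP covT small; rewrite -cards_draws.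
apply: (card_le_indexed_cover (H := star)) => [A FA|S].
  have [S /subsetIP[ST SA] cS] := exists_subset_card (covT A FA).
  by exists S; rewrite inE ?FA ?ST ?cS ?eqxx.
rewrite inE => /andP[ST /eqP cS]; apply: card_star_below => //.
by have := subset_leq_card ST; lia.
Qed.

Lemma t_cover_superset (T A : {set V}) :
  t_cover T -> T \subset A -> #|A| = k -> A \in F.
Proof.
move=> /t_coverP covT TA cA; apply: maxF => // B /covT/leq_trans; apply.
by apply/subset_leq_card/setSI.
Qed.

(** Padding [T] to size [k] with points outside [T :|: U] gives a member of [F] by maximality, and
    its trace on [U] is just [T :&: U]. The first hypothesis leaves room for the padding. *)
Lemma t_cover_meet (T U : {set V}) : k + #|U| <= #|V| -> #|T| <= k ->
  t_cover T -> t_cover U -> t <= #|T :&: U|.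
Proof.
move=> le_n le_Tk covT /t_coverP covU.
have [|W WC cW] := @exists_subset_card _ (~: (T :|: U)) (k - #|T|).
  have := cardsC (T :|: U); have := cardsUI T U; lia.
have TW0 : T :&: W = set0.
  apply/setP => x; rewrite !inE; apply/negP => /andP[Tx /(subsetP WC)].
  by rewrite !inE Tx.
have /covU : T :|: W \in F.
  apply: (t_cover_superset covT); first exact: subsetUl.
  by have := cardsUI T W; rewrite TW0 cards0; lia.
suff -> : U :&: (T :|: W) = T :&: U by [].
apply/setP => x; rewrite !inE; case Ux: (x \in U); rewrite ?andbF ?andbT //=.
case Wx: (x \in W); rewrite ?orbF // orbT; have := subsetP WC x Wx.
by rewrite !inE Ux orbT.
Qed.

(** [A] has at most [t - 1] points in [X], so the cover [x |: X] can reach [t] only with [x] and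
    exactly [t - 1] points of [X]. *)
Lemma t_cover_outside (X A : {set V}) (x : V) :
    #|X| = t -> t_cover (x |: X) -> A \in F -> ~~ (X \subset A) ->
  x \in A /\ #|X :&: A|.+1 = t.
Proof.
move=> cX /t_coverP cov FA nXA.
have ltXA : #|X :&: A| < t.
  rewrite -cX proper_card // properEneq subsetIl andbT.
  by apply: contra nXA => /eqP/setIidPl.
have := cov A FA; rewrite setIUl => cA.
case xA: (x \in A); last first.
  suff e: [set x] :&: A = set0 by move: cA; rewrite e set0U; lia.
  by apply/setP => y; rewrite !inE; case: eqP => // ->; rewrite xA.
split=> //; have := cardsUI ([set x] :&: A) (X :&: A).
have := subset_leq_card (subsetIl [set x] A); rewrite cards1; lia.
Qed.

End Intersecting.

(* Elaborating {set 'I_n} leaves [reverse_coercion] in some occurrences, so that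
   [lia] would take equal cardinals for distinct atoms. *)
Ltac set_lia := unfold reverse_coercion in *; lia.

(** * The families [H1] and [H2] are [t]-intersecting *)

(** Inclusion-exclusion inside [D], without subtraction; below, [D] is [M], [C] or [Z]. *)
Lemma leq_cardI_sub (T : finType) (A B C D : {set T}) :
  A \subset D -> B \subset D -> A :&: B \subset C -> #|A| + #|B| <= #|D| + #|C|.
Proof.
move=> AD BD /subset_leq_card AB; rewrite -cardsUI leq_add //.
by apply: subset_leq_card; rewrite subUset AD.
Qed.

Lemma famA_subset (n k t : nat) (X M A : {set 'I_n}) :
  A \in famA k t X M -> X \subset A.
Proof. by rewrite inE => /and3P[]. Qed.

Lemma famB_subset (n k t c : nat) (X M C A : {set 'I_n}) :
  A \in famB k t c X M C -> X \subset A.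
Proof. by rewrite inE => /and3P[_ /eqP <- _]; apply: subsetIl. Qed.

Lemma famA_famC_meet (n k t : nat) (X M C A B : {set 'I_n}) : 0 < k -> #|M| = k ->
  A \in famA k t X M -> B \in famC k t X M C -> t <= #|A :&: B|.
Proof.
move=> k_gt0 cM; rewrite !inE => /and3P[_ _ cA] /and4P[_ _ _ /eqP cB].
have := @leq_cardI_sub _ (A :&: M) (B :&: M) (A :&: B) M (subsetIr _ _) (subsetIr _ _).
by rewrite setIACA subsetIl => /(_ isT); lia.
Qed.

Lemma famB_famC_meet (n k t c : nat) (X M C A B : {set 'I_n}) : k <= c -> #|C| = c ->
  A \in famB k t c X M C -> B \in famC k t X M C -> t <= #|A :&: B|.
Proof.
move=> le_kc cC; rewrite !inE => /and3P[_ _ /eqP cA] /and4P[/eqP kB BC _ _].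
have := @leq_cardI_sub _ (A :&: C) B (A :&: B) C (subsetIr _ _) BC.
by rewrite setIAC subsetIl => /(_ isT); lia.
Qed.

Lemma famC_famC_meet (n k t : nat) (X M C A B : {set 'I_n}) : t + 2 <= k -> #|M| = k ->
  A \in famC k t X M C -> B \in famC k t X M C -> t <= #|A :&: B|.
Proof.
move=> le_tk cM; rewrite !inE => /and4P[_ _ _ /eqP cA] /and4P[_ _ _ /eqP cB].
have := @leq_cardI_sub _ (A :&: M) (B :&: M) (A :&: B) M (subsetIr _ _) (subsetIr _ _).
by rewrite setIACA subsetIl => /(_ isT); lia.
Qed.

Lemma H1_meet (n k t c : nat) (X M C A B : {set 'I_n}) :
    t + 2 <= k -> k <= c -> #|X| = t -> #|M| = k -> #|C| = c ->
  A \in H1 k t c X M C -> B \in H1 k t c X M C -> t <= #|A :&: B|.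
Proof.
move=> le_tk le_kc cX cM cC.
have Xmeet (A' B' : {set 'I_n}) : X \subset A' -> X \subset B' -> t <= #|A' :&: B'|.
  by move=> XA XB; rewrite -cX subset_leq_card // subsetI XA.
rewrite !in_setU -!orbA.
case/or3P=> [hA|hA|hA] /or3P[hB|hB|hB].
- exact: Xmeet (famA_subset hA) (famA_subset hB).
- exact: Xmeet (famA_subset hA) (famB_subset hB).
- by apply: famA_famC_meet hA hB => //; lia.
- exact: Xmeet (famB_subset hA) (famA_subset hB).
- exact: Xmeet (famB_subset hA) (famB_subset hB).
- exact: famB_famC_meet hA hB.
- by rewrite setIC; apply: famA_famC_meet hB hA => //; lia.
- by rewrite setIC; apply: famB_famC_meet hB hA.
- exact: famC_famC_meet hA hB.
Qed.

Lemma H2_meet (n k t : nat) (Z A B : {set 'I_n}) : #|Z| = t + 2 ->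
  A \in H2 k t Z -> B \in H2 k t Z -> t <= #|A :&: B|.
Proof.
move=> cZ; rewrite !inE => /andP[_ cA] /andP[_ cB].
have := @leq_cardI_sub _ (A :&: Z) (B :&: Z) (A :&: B) Z (subsetIr _ _) (subsetIr _ _).
by rewrite setIACA subsetIl => /(_ isT); lia.
Qed.

(** * Recognising [H1] and [H2] from their covers *)

Section Structure.

Variables (n k t : nat) (F : {set {set 'I_n}}).

Hypothesis cardF : forall A, A \in F -> #|A| = k.
Hypothesis intF : forall A B, A \in F -> B \in F -> t <= #|A :&: B|.
Hypothesis maxF : forall A : {set 'I_n}, #|A| = k ->
  (forall B, B \in F -> t <= #|A :&: B|) -> A \in F.

Lemma maximal_eq (G : {set {set 'I_n}}) : F \subset G ->
    (forall A, A \in G -> #|A| = k) ->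
    (forall A B, A \in G -> B \in G -> t <= #|A :&: B|) ->
  F = G.
Proof.
move=> FG cG iG; apply/eqP; rewrite eqEsubset FG; apply/subsetP => A GA.
by apply: maxF => [|B FB]; [apply: cG|apply: iG => //; apply: (subsetP FG)].
Qed.

Lemma H1_of_covers (X M : {set 'I_n}) :
    0 < t -> t + 2 <= k -> #|X| = t -> #|M| = k -> X \subset M ->
    (forall x, x \in M :\: X -> t_cover t F (x |: X)) ->
    (exists2 A, A \in F & ~~ (X \subset A)) ->
  exists (c : nat) (C : {set 'I_n}), [/\ (k + 1 <= c <= 2 * k - t) \/ c = n,
     #|C| = c, M \subset C & F = H1 k t c X M C].
Proof.
move=> t_gt0 le_tk cX cM XM cov [A0 FA0 nXA0].
have cMX : #|M :\: X| = k - t by rewrite cardsDS // cM cX.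
have [x0 x0MX] : exists x, x \in M :\: X by apply/card_gt0P; rewrite cMX; set_lia.
have out A : A \in F -> ~~ (X \subset A) ->
    [/\ #|A :&: X| = t - 1, #|A :&: M| = k - 1 & #|A :\: M| = 1].
  move=> FA nXA; have [_ cXA] := t_cover_outside cX (cov _ x0MX) FA nXA.
  have MXA : M :\: X \subset A.
    by apply/subsetP => x /cov covx; have [] := t_cover_outside cX covx FA nXA.
  have := cardsID X (A :&: M); rewrite -setIA (setIidPr XM) -setIDA.
  rewrite setIC in cXA; rewrite (setIidPr MXA) cMX => cAM.
  have := cardsID M A; rewrite (cardF FA); split; set_lia.
(* By [out], a member not containing [X] has the form [M - x + y]; [Y] collects these [y]. *)
pose Y := [set y | (y \notin M) && [exists A in F, ~~ (X \subset A) && (y \in A)]].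
have cMY : #|M :|: Y| = k + #|Y|.
  have := cardsUI M Y; rewrite cM (_ : M :&: Y = set0) ?cards0 ?addn0 //.
  by apply/setP => y; rewrite !inE; case: (y \in M).
have subMY A : A \in F -> ~~ (X \subset A) -> A \subset M :|: Y.
  move=> FA nXA; apply/subsetP => y Ay; rewrite !inE; case: (y \in M) => //=.
  by apply/exists_inP; exists A; rewrite // nXA.
have famC_out (C A : {set 'I_n}) : A \in F -> ~~ (X \subset A) -> A \subset C ->
    A \in famC k t X M C.
  by move=> FA nXA sAC; have [cAX cAM _] := out A FA nXA; rewrite !inE cardF // sAC cAX cAM !eqxx.
have famA_in A : A \in F -> X \subset A -> A :&: M != X -> A \in famA k t X M.
  move=> FA XA neq; rewrite !inE cardF // XA eqxx /= addn1 -cX proper_card //.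
  by rewrite properEneq eq_sym neq subsetI XA.
case: (boolP [exists B in F, B :&: M == X]) => [/exists_inP[B0 FB0 /eqP B0M]|noB].
  (* Take [A = M - x + y]. If [B] missed [y], then [A :&: B] would lie in [A :&: X], which has only
     [t - 1] points. *)
  have YB B : B \in F -> B :&: M = X -> Y \subset B.
    move=> FB BM; apply/subsetP => y; rewrite inE => /andP[yM /exists_inP[A FA /andP[nXA Ay]]].
    have [cAX _ /eqP/cards1P[y' AM]] := out A FA nXA.
    have yy' : y = y' by apply/set1P; rewrite -AM inE yM.
    apply/negPn/negP => yB.
    have : A :&: B \subset A :&: X.
      apply/subsetP => z; rewrite -BM !inE => /andP[Az Bz]; rewrite Az Bz.
      apply/negPn/negP => zM; have : z \in A :\: M by rewrite inE Az zM.
      by rewrite AM -yy' => /set1P ez; rewrite -ez Bz in yB.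
    by move/subset_leq_card; have := intF FA FB; set_lia.
  have cXY : #|X :|: Y| = t + #|Y|.
    have := cardsUI X Y; rewrite cX (_ : X :&: Y = set0) ?cards0 ?addn0 //.
    by apply/setP => y; rewrite !inE; case Xy: (y \in X); rewrite // (subsetP XM).
  have Y_gt0 : 0 < #|Y|.
    have [_ _ cAM] := out A0 FA0 nXA0; rewrite -cAM; apply: subset_leq_card.
    apply/subsetP => y; rewrite inE => /andP[yM yA0].
    by have := subsetP (subMY _ FA0 nXA0) y yA0; rewrite inE (negPf yM).
  exists (k + #|Y|), (M :|: Y); split => //; last 1 first.
  - apply: maximal_eq => [|A|A B]; last 1 first.
    + by apply: H1_meet => //; set_lia.
    + apply/subsetP => A FA; rewrite !in_setU -orbA; apply/or3P.
      case: (boolP (X \subset A)) => [XA|nXA]; last first.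
        by apply: Or33; apply: famC_out => //; apply: subMY.
      case: (eqVneq (A :&: M) X) => [AM|AM]; last by apply: Or31; apply: famA_in.
      apply: Or32; rewrite !inE cardF // AM setIUr AM (setIidPr (YB _ FA AM)) cXY !eqxx /=.
      by apply/eqP; set_lia.
    by rewrite !inE -orbA => /or3P[] /andP[/eqP].
  (* [B0] contains the disjoint sets [X] and [Y], which bounds [c = k + #|Y|] by [2 * k - t];
     [c >= k + 1] because [A0] supplies a point of [Y]. *)
  - left; suff: t + #|Y| <= k by set_lia.
    rewrite -cXY -(cardF FB0); apply: subset_leq_card.
    by rewrite subUset (YB _ FB0 B0M) andbT -B0M subsetIl.
  - exact: subsetUl.
(* No member meets [M] exactly in [X], so [famA] and [famC] with [C = [n]] already cover [F]. *)
exists n, setT; split; rewrite ?cardsT ?card_ord ?subsetT //; first by right.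
apply: maximal_eq => [|A|A B]; last 1 first.
- apply: H1_meet => //; last by rewrite cardsT card_ord.
  by rewrite -cM -[leqRHS]card_ord max_card.
- apply/subsetP => A FA; rewrite !in_setU -orbA; apply/or3P.
  case: (boolP (X \subset A)) => [XA|nXA]; last first.
    by apply: Or33; apply: famC_out => //; apply: subsetT.
  apply: Or31; apply: famA_in => //; apply: contra noB => AM.
  by apply/exists_inP; exists A.
by rewrite !inE -orbA => /or3P[] /andP[/eqP].
Qed.

(** A member containing [x] has [t] further points in the cover [Z :\ x], and likewise for [y] and
    [z]. A member missing all three would need [t] points among the [t - 1] remaining ones. *)
Lemma H2_of_triangle (Z : {set 'I_n}) (x y z : 'I_n) : 0 < t ->
    #|Z| = t + 2 -> [/\ x \in Z, y \in Z & z \in Z] ->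
    [/\ x != y, x != z & y != z] ->
    [/\ t_cover t F (Z :\ x), t_cover t F (Z :\ y) & t_cover t F (Z :\ z)] ->
  F = H2 k t Z.
Proof.
move=> t_gt0 cZ [Zx Zy Zz] [nxy nxz nyz] [/t_coverP cx /t_coverP cy /t_coverP cz].
have inA w (A : {set 'I_n}) : w \in Z -> w \in A -> t <= #|(Z :\ w) :&: A| -> t + 1 <= #|A :&: Z|.
  move=> Zw Aw; rewrite (cardsD1 w (A :&: Z)) !inE Aw Zw addnC leq_add2l.
  by rewrite setIDAC setIC.
have cxyz : #|Z :\ x :\ y :\ z| < t.
  have := cardsD1 x Z; have := cardsD1 y (Z :\ x); have := cardsD1 z (Z :\ x :\ y).
  by rewrite !inE Zx Zy Zz !(eq_sym y) !(eq_sym z) nxy nxz nyz; set_lia.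
apply: maximal_eq => [|A|A B]; last exact: H2_meet.
- apply/subsetP => A FA; rewrite !inE cardF // eqxx /=.
  case Ax: (x \in A); first exact: inA (cx A FA).
  case Ay: (y \in A); first exact: inA (cy A FA).
  case Az: (z \in A); first exact: inA (cz A FA).
  suff /subset_leq_card : (Z :\ x) :&: A \subset Z :\ x :\ y :\ z.
    by have := cx A FA; set_lia.
  apply/subsetP => w; rewrite !inE => /andP[/andP[-> ->] Aw]; rewrite !andbT.
  by apply/andP; split; apply: contraTneq Aw => ->; rewrite ?Ay ?Az.
by rewrite inE => /andP[]; rewrite inE => /eqP.
Qed.

End Structure.

(** * Upper bounds on [#|F|] from its covers of size [t + 1] *)

Section Counting.

Variables (V : finType) (k t : nat) (F : {set {set V}}).

Hypothesis cardF : forall A, A \in F -> #|A| = k.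
Hypothesis intF : forall A B, A \in F -> B \in F -> t <= #|A :&: B|.

(** This is the set called [L] in the overview. *)
Definition cover_ext (X : {set V}) :=
  [set x | (x \notin X) && t_cover t F (x |: X)].

Lemma cover_ext_outside (X A : {set V}) : #|X| = t -> A \in F ->
  ~~ (X \subset A) -> cover_ext X \subset A.
Proof.
move=> cX FA nXA; apply/subsetP => x; rewrite inE => /andP[_ covx].
by have [] := t_cover_outside cX covx FA nXA.
Qed.

Lemma card_star_hitting (X : {set V}) : #|X| = t ->
  #|[set A in star F X | ~~ [disjoint A & cover_ext X]]|
    <= #|cover_ext X| * 'C(#|V| - t - 1, k - t - 1).
Proof.
move=> cX; apply: (card_le_indexed_cover (H := fun x => star F (x |: X))) => [A|x].
  rewrite !inE => /andP[/andP[FA XA] /pred0Pn[x /andP[/= Ax Lx]]].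
  by exists x => //; rewrite inE FA subUset sub1set Ax.
rewrite inE => /andP[nXx _]; apply: leq_trans (card_star cardF _) _.
by rewrite cardsU1 nXx cX -!subnDA addnC.
Qed.

(** A member not containing [X] contains all of [cover_ext X] and misses exactly one [z] in [X]. [U]
    is left free: it will be all of [cover_ext X] when that has two points, and three of its points
    when it is larger. *)
Lemma card_outside (X U : {set V}) (m : nat) : #|X| = t ->
    U \subset cover_ext X -> 0 < #|cover_ext X| ->
    (forall z, z \in X -> #|star F (U :|: X :\ z)| <= m) ->
  #|[set A in F | ~~ (X \subset A)]| <= t * m.
Proof.
move=> cX UL /card_gt0P[x0 Lx0] bnd; rewrite -cX.
apply: (card_le_indexed_cover (H := fun z => star F (U :|: X :\ z))) => // A.
rewrite inE => /andP[FA nXA].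
have [_ cXA] : x0 \in A /\ #|X :&: A|.+1 = t.
  by apply: t_cover_outside FA nXA => //; move: Lx0; rewrite inE => /andP[].
have /subsetPn[z Xz Az] := nXA.
exists z => //; rewrite inE FA subUset.
rewrite (subset_trans UL (cover_ext_outside cX FA nXA)) /=.
have /eqP <- : X :&: A == X :\ z; last exact: subsetIr.
rewrite eqEcard subsetD1 subsetIl inE (negPf Az) andbF /=.
by have := cardsD1 z X; rewrite Xz; lia.
Qed.

Hypothesis le_tk : t <= k.

(** [B] contains [cover_ext X] and [t - 1] points of [X]. A member avoiding [cover_ext X] must meet
    [B] once more, at one of the [k - t + 1 - #|cover_ext X|] other points, and such a point does
    not extend [X] to a cover. *)
Lemma card_star_missing (X : {set V}) : #|X| = t ->
    (exists2 A, A \in F & ~~ (X \subset A)) -> 0 < #|cover_ext X| ->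
  #|[set A in star F X | [disjoint A & cover_ext X]]|
    <= (k - t + 1 - #|cover_ext X|) * ((k - t + 1) * 'C(#|V| - t - 2, k - t - 2)).
Proof.
move=> cX [B FB nXB] /card_gt0P[x0 Lx0]; set L := cover_ext X.
have LB : L \subset B := cover_ext_outside cX FB nXB.
have [_ cXB] : x0 \in B /\ #|X :&: B|.+1 = t.
  by apply: t_cover_outside FB nXB => //; move: Lx0; rewrite inE => /andP[].
have cBXL : #|B :\: (X :|: L)| = k - t + 1 - #|L|.
  have dis : X :&: B :&: L = set0.
    by apply/setP => x; rewrite in_set0 !in_setI [x \in L]inE; case: (x \in X); rewrite ?andbF.
  have := cardsID (X :|: L) B; rewrite (cardF FB) setIUr (setIidPr LB) setIC.
  by have := cardsUI (X :&: B) L; rewrite dis cards0; lia.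
rewrite -cBXL; apply: (card_le_indexed_cover (H := fun x => star F (x |: X))) => [A|x].
  rewrite !inE => /andP[/andP[FA XA] disAL].
  case: (set_0Vmem (A :&: (B :\: (X :|: L)))) => [AB0|[x]]; last first.
    rewrite inE => /andP[Ax BXLx]; exists x => //.
    by rewrite inE FA subUset sub1set Ax.
  have /subset_leq_card : A :&: B \subset X :&: B.
    apply/subsetP => x; rewrite !inE => /andP[Ax Bx]; rewrite Bx andbT.
    move/setP/(_ x): AB0; rewrite in_setI in_setD in_setU in_set0 Ax Bx andbT /=.
    by move=> /negbFE/orP[//|Lx]; rewrite (disjointFr disAL) in Lx.
  by have := intF FA FB; lia.
rewrite in_setD in_setU negb_or => /andP[/andP[Xx Lx] Bx].
apply: card_noncover_star => //; first by rewrite cardsU1 Xx cX addnC.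
by move: Lx; rewrite inE Xx.
Qed.

Lemma card_star_split (X : {set V}) :
  #|F| <= #|[set A in star F X | ~~ [disjoint A & cover_ext X]]|
    + #|[set A in star F X | [disjoint A & cover_ext X]]|
    + #|[set A in F | ~~ (X \subset A)]|.
Proof.
have sub : F \subset [set A in star F X | ~~ [disjoint A & cover_ext X]]
    :|: [set A in star F X | [disjoint A & cover_ext X]]
    :|: [set A in F | ~~ (X \subset A)].
  apply/subsetP => A FA; rewrite !inE FA.
  by case: (X \subset A); case: [disjoint _ & _].
apply: leq_trans (subset_leq_card sub) _.
by apply: leq_trans (leq_card_setU _ _) _; rewrite leq_add2r leq_card_setU.
Qed.

(** A member not containing [T] meets it in [T :\ z] for some [z]. A point extending [T :\ z] to a
    cover must give [T] back, so [cover_ext (T :\ z)] is [[set z]] and [card_star_missing] applies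
    with factor [k - t]. *)
Lemma card_unique_cover (T : {set V}) : #|T| = t + 1 -> t_cover t F T ->
    (forall U : {set V}, #|U| = t + 1 -> t_cover t F U -> U = T) ->
    (forall X : {set V}, #|X| = t -> exists2 A, A \in F & ~~ (X \subset A)) ->
  #|F| <= 'C(#|V| - t - 1, k - t - 1)
          + (t + 1) * ((k - t) * ((k - t + 1) * 'C(#|V| - t - 2, k - t - 2))).
Proof.
move=> cT covT uniqT nontriv.
pose G := [set A in F | ~~ (T \subset A)].
have sub : F \subset star F T :|: G.
  by apply/subsetP => A FA; rewrite !inE FA /=; case: (T \subset A).
apply: leq_trans (subset_leq_card sub) _; apply: leq_trans (leq_card_setU _ _) _.
apply: leq_add; first by have := card_star cardF T; rewrite cT !subnDA.
rewrite -cT; apply: (card_le_indexed_cover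
    (H := fun z => [set A in star F (T :\ z) | [disjoint A & cover_ext (T :\ z)]])).
  move=> A; rewrite inE => /andP[FA /subsetPn[z Tz Az]]; exists z => //.
  have /eqP eTA : T :\ z == T :&: A.
    rewrite eq_sym eqEcard subsetD1 subsetIl inE (negPf Az) andbF /=.
    by have := cardsD1 z T; rewrite Tz; move/t_coverP/(_ A FA): covT; lia.
  have ext : cover_ext (T :\ z) \subset [set z].
    apply/subsetP => x; rewrite !inE => /andP[nx covx].
    have : x \in T.
      rewrite -(uniqT _ _ covx) ?setU11 // cardsU1 !inE nx.
      by have := cardsD1 z T; rewrite Tz; lia.
    by move: nx; case: eqP => //= _ /negPf ->.
  rewrite !inE FA eTA subsetIr -eTA /=.
  by apply: disjointWr ext _; rewrite disjoint_sym disjoints1.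
move=> z Tz; have cX : #|T :\ z| = t by have := cardsD1 z T; rewrite Tz; lia.
have cL : #|cover_ext (T :\ z)| = 1.
  apply/eqP/cards1P; exists z; apply/setP => x; rewrite !inE.
  case: (eqVneq x z) => [->|nxz] /=; first by rewrite setD1K.
  apply/negP => /andP[nTx covx].
  have : x \in T by rewrite -(uniqT _ _ covx) ?setU11 // cardsU1 !inE nxz nTx cX addnC.
  by rewrite (negPf nTx).
by have := card_star_missing cX (nontriv _ cX); rewrite cL addnK; apply.
Qed.

Lemma card_ext_star (X U : {set V}) (z : V) : #|X| = t -> z \in X ->
  U \subset cover_ext X -> #|U :|: X :\ z| + 1 = #|U| + t.
Proof.
move=> cX Xz UL; have UX : U :&: (X :\ z) = set0.
  apply/setP => x; rewrite !inE; case Ux: (x \in U) => //=.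
  by have := subsetP UL x Ux; rewrite inE => /andP[/negPf ->]; rewrite andbF.
by have := cardsD1 z X; have := cardsUI U (X :\ z); rewrite UX cards0 Xz; lia.
Qed.

(** For [z] in [X], the set [cover_ext X :|: X :\ z] has [t + 1] points but misses [z], so it is not
    a cover and [card_noncover_star] bounds its star. *)
Lemma card_two_covers (X : {set V}) : #|X| = t ->
    (exists2 A, A \in F & ~~ (X \subset A)) ->
    (forall U : {set V}, #|U| = t + 1 -> t_cover t F U -> X \subset U) ->
    #|cover_ext X| = 2 ->
  #|F| <= 2 * 'C(#|V| - t - 1, k - t - 1)
    + ((k - t - 1) * (k - t + 1) + t * (k - t + 1)) * 'C(#|V| - t - 2, k - t - 2).
Proof.
move=> cX ntX starX cL; apply: leq_trans (card_star_split X) _.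
have hit := card_star_hitting cX.
have miss := card_star_missing cX ntX.
have out := @card_outside X (cover_ext X)
  ((k - t + 1) * 'C(#|V| - t - 2, k - t - 2)) cX (subxx _).
rewrite cL in hit miss out; have {}miss := miss isT.
rewrite mulnDl addnA -!mulnA; apply: leq_add; last first.
  apply: out => // z Xz; have cU := card_ext_star cX Xz (subxx _).
  have {}cU : #|cover_ext X :|: X :\ z| = t + 1 by lia.
  apply: card_noncover_star => //; apply/negP => covU.
  by have := subsetP (starX _ cU covU) z Xz; rewrite !inE Xz eqxx.
by apply: leq_add => //; move: miss; rewrite (_ : k - t + 1 - 2 = k - t - 1) //; lia.
Qed.

(** Three points of [cover_ext X] together with [X :\ z] make [t + 2] points, so the trivial star
    bound suffices outside [X]. *)
Lemma card_many_covers (X : {set V}) : #|X| = t ->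
    (exists2 A, A \in F & ~~ (X \subset A)) -> 2 < #|cover_ext X| ->
  #|F| <= #|cover_ext X| * 'C(#|V| - t - 1, k - t - 1)
    + ((k - t + 1 - #|cover_ext X|) * (k - t + 1) + t) * 'C(#|V| - t - 2, k - t - 2).
Proof.
move=> cX ntX L_gt2; apply: leq_trans (card_star_split X) _.
have L_gt0 : 0 < #|cover_ext X| by lia.
have [U UL cU] := exists_subset_card L_gt2.
rewrite mulnDl addnA -!mulnA; apply: leq_add; last first.
  apply: (card_outside cX UL) => // z Xz; have := card_ext_star cX Xz UL => cUz.
  apply: leq_trans (card_star cardF _) _.
  by rewrite -!subnDA (_ : #|U :|: X :\ z| = t + 2) //; lia.
by apply: leq_add; [apply: card_star_hitting|apply: card_star_missing].
Qed.

Lemma card_le_H2 (Z : {set V}) : #|Z| = t + 2 ->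
    (forall A, A \in F -> t + 1 <= #|A :&: Z|) ->
  #|F| <= (t + 2) * 'C(#|V| - t - 1, k - t - 1).
Proof.
move=> cZ FZ; have cI : #|[set W : {set V} | W \subset Z & #|W| == t + 1]| = t + 2.
  by rewrite cards_draws cZ addn1 addn2 binSn.
rewrite -{1}cI; apply: (card_le_indexed_cover (H := star F)) => [A FA|W].
  have [W /subsetIP[WA WZ] cW] := exists_subset_card (FZ A FA).
  by exists W; rewrite !inE ?FA ?WZ ?cW ?eqxx.
by rewrite inE => /andP[_ /eqP cW]; have := card_star cardF W; rewrite cW !subnDA.
Qed.

End Counting.

(** * Numerical comparison of the bounds with the size hypothesis *)

(** Read [s = k - t], [N = n - t], [c = 'C(s, 2)], [f = #|F|], with [E] and [D] the two binomials of
    the size hypothesis. If [f <= a * E + b * D], then [(s - a) * E <= (b + c) * D]; multiplying by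
    [s - 1] and cancelling [D] contradicts the last hypothesis. *)
Lemma size_gap (s N D E f a b c : nat) : 1 < s -> 0 < D -> (s - 1) * E = (N - 1) * D ->
    s * E <= f + c * D -> a <= s -> (s - 1) * (b + c) < (s - a) * (N - 1) ->
  a * E + b * D < f.
Proof.
move=> s_gt1 D_gt0 ED le_f le_as lt_bN; rewrite ltnNge; apply/negP => le_f'.
have {le_f le_f'} le_E : (s - a) * E <= (b + c) * D by rewrite mulnBl mulnDl; lia.
have : (s - a) * (N - 1) * D <= (s - 1) * (b + c) * D.
  by rewrite -mulnA -ED mulnCA -!mulnA leq_mul2l le_E orbT.
by rewrite leq_pmul2r // leqNgt lt_bN.
Qed.

Section Arithmetic.

Variables (s t N c q : nat).
Hypotheses (s_gt1 : 1 < s) (t_gt0 : 0 < t).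
Hypotheses (def_c : 2 * c = s * (s - 1)) (def_q : 2 * q = (t + 2) * (t + 1)).
Hypotheses (le_qN : q * (s + 1) ^ 2 <= N) (le_sN : (s + 2) * (s + 1) ^ 2 <= 2 * N).

Let q_ge : 2 * t + 1 <= q.
Proof. have : t <= t * t by rewrite leq_pmulr. by lia. Qed.

Let N_ge : (2 * t + 1) * (s + 1) ^ 2 <= N.
Proof. by apply: leq_trans le_qN; rewrite leq_mul2r q_ge orbT. Qed.

(** The [gap_] lemmas verify the last hypothesis of [size_gap] for the pairs [(a, b)] of the
    counting bounds. Here [a = 0], and [b] comes from a minimal cover of size [t + 2]. *)
Lemma gap_no_cover : (s - 1) * (q * (s + 1) ^ 2 + c) < (s - 0) * (N - 1).
Proof.
have le1 : (s - 1) * (q * (s + 1) ^ 2) <= (s - 1) * N by rewrite leq_mul2l le_qN orbT.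
(* The substitution removes truncated subtraction and leaves polynomials. *)
move: le1 le_sN def_c; have [p ->] : exists p, s = p + 2 by exists (s - 2); lia.
rewrite (_ : p + 2 - 1 = p + 1) ?subn0; last lia.
move=> le1 le2 e; have : 2 * ((p + 1) * c) = (p + 1) * ((p + 2) * (p + 1)) by rewrite mulnCA e.
have : (p + 1) * N + N = (p + 2) * N by ring.
by rewrite mulnDr mulnBr muln1; move: le1 le2; clear; lia.
Qed.

Lemma gap_unique_cover :
  (s - 1) * ((t + 1) * (s * (s + 1)) + c) < (s - 1) * (N - 1).
Proof.
rewrite ltn_pmul2l; last lia.
have : (2 * t + 1) * (s + 1) ^ 2
  = (t + 1) * (s * (s + 1)) + (t * (s + 1) ^ 2 + (t + 1) * (s + 1)) by ring.
have : (s + 1) ^ 2 <= t * (s + 1) ^ 2 by rewrite leq_pmull.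
move: N_ge def_c s_gt1; clear; nia.
Qed.

Lemma gap_two_covers : 2 < s ->
  (s - 1) * ((s - 1) * (s + 1) + t * (s + 1) + c) < (s - 2) * (N - 1).
Proof.
move=> s_gt2; have := leq_mul (leqnn (s - 2)) N_ge; move: def_c; clear -s_gt2 t_gt0.
have [p ->] : exists p, s = p + 3 by exists (s - 3); lia.
have [u ->] : exists u, t = u + 1 by exists (t - 1); lia.
rewrite (_ : p + 3 - 1 = p + 2) 1?(_ : p + 3 - 2 = p + 1); [|lia..].
move=> e; have : 2 * ((p + 2) * c) = (p + 2) * ((p + 3) * (p + 2)) by rewrite mulnCA e.
by rewrite mulnBr muln1; clear; lia.
Qed.

Lemma gap_many_covers (l : nat) : 2 < l < s ->
  (s - 1) * ((s + 1 - l) * (s + 1) + t + c) < (s - l) * (N - 1).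
Proof.
move=> /andP[l_gt2 lt_ls].
(* This is the case [l = s - 1]. *)
have base : (s - 1) * (2 * (s + 1) + t + c) < N - 1.
  move: def_c le_sN N_ge; have [p ->] : exists p, s = p + 2 by exists (s - 2); lia.
  (* For [t <= s + 2] the cubic bound [le_sN] is strong enough; for larger [t], [N_ge] is, since it
     grows with [t]. *)
  case: (leqP t (p + 4)) => [le_tp|lt_pt].
    have := leq_mul (leqnn (p + 1)) le_tp.
    rewrite (_ : p + 2 - 1 = p + 1); last lia.
    move=> le0 e; have : 2 * ((p + 1) * c) = (p + 1) * ((p + 2) * (p + 1)) by rewrite mulnCA e.
    move: le0; clear; lia.
  have := leq_mul (leqnn (p + 1)) (ltnW lt_pt).
  have := leq_mul (leqnn ((p + 1) ^ 2)) (ltnW lt_pt).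
  rewrite (_ : p + 2 - 1 = p + 1); last lia.
  move=> le0 le1 e; have : 2 * ((p + 1) * c) = (p + 1) * ((p + 2) * (p + 1)) by rewrite mulnCA e.
  move: le0 le1; clear; lia.
(* Lowering [l] by one adds [(s - 1) * (s + 1)] on the left and [N - 1] on the right. *)
have slope : (s - 1) * (s + 1) <= N - 1.
  by apply: leq_trans (ltnW base); rewrite leq_mul2l; apply/orP; right; lia.
have [j [-> ->]] : exists j, s + 1 - l = j.+2 /\ s - l = j.+1 by exists (s - l - 1); lia.
have -> : (s - 1) * (j.+2 * (s + 1) + t + c)
  = (s - 1) * (2 * (s + 1) + t + c) + j * ((s - 1) * (s + 1)) by rewrite -add2n; ring.
by rewrite mulSn -addSn leq_add // leq_mul2l slope orbT.
Qed.

Lemma gap_H2 : t + 2 < s -> (s - 1) * (0 + c) < (s - (t + 2)) * (N - 1).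
Proof.
move=> lt_ts; have base : (s - 1) * c < N - 1.
  move: def_c le_sN; have [p ->] : exists p, s = p + 2 by exists (s - 2); lia.
  rewrite (_ : p + 2 - 1 = p + 1); last lia.
  move=> e; have : 2 * ((p + 1) * c) = (p + 1) * ((p + 2) * (p + 1)) by rewrite mulnCA e.
  by clear; lia.
by apply: leq_trans base _; rewrite leq_pmull // subn_gt0.
Qed.

(** The bound of [card_min_cover] decreases with the size [t + m] of the cover: the ratio of
    consecutive values is [(t + m + 1) * (s + 1) * (s - m)] over [(m + 1) * (N - m)], at most 1 by
    [coef]. *)
Lemma cover_bound_step (m : nat) : m < s ->
  'C(t + m.+1, t) * ((s + 1) ^ m.+1 * 'C(N - m.+1, s - m.+1))
    <= 'C(t + m, t) * ((s + 1) ^ m * 'C(N - m, s - m)).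
Proof.
move=> lt_ms.
have coef : (t + m.+1) * (s + 1) * (s - m) <= m.+1 * (N - m).
  have le1 : (t + 1) * (s + 1) * s <= N - m.
    have : s + 1 <= t * (s + 1) by rewrite leq_pmull.
    by move: N_ge lt_ms; clear; lia.
  have := leq_mul (leqnn m.+1) le1; apply: leq_trans; rewrite mulnA leq_mul ?leq_subr //.
  rewrite mulnA leq_mul2r; apply/orP; right; lia.
have eT : (t + m.+1) * 'C(t + m, t) = m.+1 * 'C(t + m.+1, t).
  by have := mul_bin_down (t + m.+1) t; rewrite addKn addnS.
have eN : (N - m) * 'C(N - m.+1, s - m.+1) = (s - m) * 'C(N - m, s - m).
  have := mul_bin_diag (N - m) (s - m.+1).
  by rewrite -subnS (_ : (s - m.+1).+1 = s - m) //; lia.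
have pos : 0 < m.+1 * (N - m).
  by rewrite muln_gt0 /= subn_gt0; move: N_ge lt_ms; clear; lia.
rewrite -(leq_pmul2l pos) expnS.
have -> : m.+1 * (N - m) * ('C(t + m.+1, t) * ((s + 1) * (s + 1) ^ m * 'C(N - m.+1, s - m.+1)))
  = (m.+1 * 'C(t + m.+1, t)) * (s + 1) * (s + 1) ^ m * ((N - m) * 'C(N - m.+1, s - m.+1)).
  by ring.
rewrite -eT eN.
have -> : (t + m.+1) * 'C(t + m, t) * (s + 1) * (s + 1) ^ m * ((s - m) * 'C(N - m, s - m))
  = (t + m.+1) * (s + 1) * (s - m) * ('C(t + m, t) * ((s + 1) ^ m * 'C(N - m, s - m))).
  by ring.
by rewrite leq_mul2r coef orbT.
Qed.

Lemma cover_bound (m : nat) : 1 < m -> m <= s ->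
  'C(t + m, t) * ((s + 1) ^ m * 'C(N - m, s - m))
    <= 'C(t + 2, t) * ((s + 1) ^ 2 * 'C(N - 2, s - 2)).
Proof.
elim: m => // m IHm m_gt1 lt_ms; case: (eqVneq m 1) => [->//|m_neq1].
by apply: leq_trans (cover_bound_step lt_ms) (IHm _ _); lia.
Qed.

End Arithmetic.

(** * Triangles of covers and minimal covers *)

(** Let [z] lie in [T1 :&: T2] but not in [T3]. Meeting [T3] in [t] points forces [T1 :\ z] and
    [T2 :\ z] into [T3], and sizes then give [T3 = (T1 :|: T2) :\ z]. *)
Lemma covers_triangle (V : finType) (t : nat) (T1 T2 T3 : {set V}) :
    [/\ #|T1| = t + 1, #|T2| = t + 1 & #|T3| = t + 1] ->
    #|T1 :&: T2| = t -> t <= #|T3 :&: T1| -> t <= #|T3 :&: T2| ->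
    ~~ (T1 :&: T2 \subset T3) ->
  exists x y z : V,
    [/\ #|T1 :|: T2| = t + 2,
        [/\ x \in T1 :|: T2, y \in T1 :|: T2 & z \in T1 :|: T2],
        [/\ x != y, x != z & y != z]
      & [/\ T1 = (T1 :|: T2) :\ x, T2 = (T1 :|: T2) :\ y & T3 = (T1 :|: T2) :\ z]].
Proof.
move=> [c1 c2 c3] c12 c31 c32 /subsetPn[z]; rewrite inE => /andP[z1 z2] z3.
have cZ : #|T1 :|: T2| = t + 2 by have := cardsUI T1 T2; lia.
have [x x2 x1] : exists2 x, x \in T2 & x \notin T1.
  by apply/subsetPn/negP => /setIidPr e; move: c12; rewrite e; lia.
have [y y1 y2] : exists2 y, y \in T1 & y \notin T2.
  by apply/subsetPn/negP => /setIidPl e; move: c12; rewrite e; lia.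
have del (T : {set V}) w : T \subset T1 :|: T2 -> #|T| = t + 1 ->
    w \in T1 :|: T2 -> w \notin T -> T = (T1 :|: T2) :\ w.
  move=> sT cT Zw Tw; apply/eqP; rewrite eqEcard subsetD1 sT Tw /=.
  by have := cardsD1 w (T1 :|: T2); rewrite Zw; lia.
have sub3 (T : {set V}) : #|T| = t + 1 -> z \in T -> t <= #|T3 :&: T| -> T :\ z \subset T3.
  move=> cT Tz cT3; have /eqP <- : T3 :&: T == T :\ z; last exact: subsetIl.
  rewrite eqEcard subsetD1 subsetIr inE (negPf z3) /=.
  by have := cardsD1 z T; rewrite Tz; lia.
have s3 : (T1 :|: T2) :\ z = T3.
  apply/eqP; rewrite eqEcard setDUl subUset !sub3 //= -setDUl.
  by have := cardsD1 z (T1 :|: T2); rewrite inE z1; lia.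
exists x, y, z; split=> //.
- by rewrite !inE x2 y1 z1 !orbT.
- by split; [apply: contraNneq x1 => -> | apply: contraNneq x1 => -> | apply: contraNneq y2 => ->].
- by split=> //; apply: del; rewrite ?subsetUl ?subsetUr // !inE ?x2 ?y1 ?orbT.
Qed.

Section MinimalCover.

Variables (V : finType) (t : nat) (F : {set {set V}}).
Hypothesis le_tV : t <= #|V|.
Hypothesis nontriv : forall X : {set V}, #|X| = t ->
  exists2 A, A \in F & ~~ (X \subset A).

Lemma nontrivial_family_inhabited : exists A, A \in F.
Proof.
have [|X _ cX] := @exists_subset_card _ [set: V] t; first by rewrite cardsT.
by have [A FA _] := nontriv cX; exists A.
Qed.

(** A cover with [t] points would lie in every member, against non-triviality. *)
Lemma t_cover_card_gt (S : {set V}) : t_cover t F S -> t < #|S|.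
Proof.
move=> /t_coverP covS; rewrite ltnNge; apply/negP => le_St.
have [A FA] := nontrivial_family_inhabited.
have cS : #|S| = t by have := subset_leq_card (subsetIl S A); have := covS A FA; lia.
have [B FB /negP[]] := nontriv cS; apply/setIidPl/eqP.
by rewrite eqEcard subsetIl cS covS.
Qed.

Lemma exists_min_cover (A : {set V}) : t_cover t F A ->
  exists T : {set V}, [/\ t_cover t F T, #|T| <= #|A|
    & forall S : {set V}, #|S| < #|T| -> ~~ t_cover t F S].
Proof.
move=> covA; have [T covT minT] := arg_minnP (fun T : {set V} => #|T|) covA.
exists T; split=> // [|S]; first exact: minT.
by apply: contraTN => /minT; rewrite leqNgt.
Qed.

End MinimalCover.

(** * Structure of large families *)

Section LargeFamilies.

Variables (n k t : nat) (F : {set {set 'I_n}}).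

Hypotheses (t_gt0 : 0 < t) (le_tk : t + 2 <= k).
Hypothesis le_qn : 'C(t + 2, 2) * (k - t + 1) ^ 2 + t <= n.
Hypothesis le_sn : (k - t + 2) * (k - t + 1) ^ 2 + 2 * t <= 2 * n.

Hypothesis cardF : forall A, A \in F -> #|A| = k.
Hypothesis intF : forall A B, A \in F -> B \in F -> t <= #|A :&: B|.
Hypothesis maxF : forall A : {set 'I_n}, #|A| = k ->
  (forall B, B \in F -> t <= #|A :&: B|) -> A \in F.
Hypothesis nontriv : forall X : {set 'I_n}, #|X| = t ->
  exists2 A, A \in F & ~~ (X \subset A).
Hypothesis sizeF : (k - t) * 'C(n - t - 1, k - t - 1)
  <= #|F| + 'C(k - t, 2) * 'C(n - t - 2, k - t - 2).

Let s_gt1 : 1 < k - t. Proof. lia. Qed.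

Let def_c : 2 * 'C(k - t, 2) = (k - t) * (k - t - 1).
Proof. by rewrite -mul_bin_diag bin1 subn1. Qed.

Let def_q : 2 * 'C(t + 2, 2) = (t + 2) * (t + 1).
Proof. by rewrite -mul_bin_diag bin1 !addn2 addn1. Qed.

Let le_qN : 'C(t + 2, 2) * (k - t + 1) ^ 2 <= n - t.
Proof. by rewrite leq_subRL ?(leq_trans _ le_qn) ?leq_addl // addnC. Qed.

Let le_sN : (k - t + 2) * (k - t + 1) ^ 2 <= 2 * (n - t).
Proof. by rewrite mulnBr leq_subRL ?(leq_trans _ le_sn) ?leq_addl // addnC. Qed.

(** The room that [t_cover_meet] requires for covers of size [t + 1]. *)
Let le_2kn : k + t + 1 <= n.
Proof.
have [s ek] : exists s, k = t + s.+2 by exists (k - t - 2); lia.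
have := leq_mul (_ : 2 * t + 1 <= 'C(t + 2, 2)) (leqnn ((k - t + 1) ^ 2)).
move: le_qn; rewrite ek addKn; have := leq_mul t_gt0 t_gt0; move: def_q => /=.
set q := 'C(_, _); clear; nia.
Qed.

Let sizeF_gap (a b : nat) : a <= k - t ->
    (k - t - 1) * (b + 'C(k - t, 2)) < (k - t - a) * (n - t - 1) ->
  a * 'C(n - t - 1, k - t - 1) + b * 'C(n - t - 2, k - t - 2) < #|F|.
Proof.
apply: (size_gap s_gt1 _ _ sizeF); first by rewrite bin_gt0; lia.
have := mul_bin_diag (n - t - 1) (k - t - 2).
have -> : (n - t - 1).-1 = n - t - 2 by lia.
by have -> : (k - t - 2).+1 = k - t - 1 by lia.
Qed.

(** Any member is itself a cover, so a minimal cover has size [t + m] with [0 < m <= k - t]. If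
    [m > 1], [cover_bound] reduces to [m = 2], which [gap_no_cover] excludes. *)
Lemma exists_succ_cover :
  exists2 T : {set 'I_n}, #|T| = t + 1 & t_cover t F T.
Proof.
have le_tV : t <= #|'I_n| by rewrite card_ord; lia.
have [A FA] := nontrivial_family_inhabited le_tV nontriv.
have covA : t_cover t F A by apply/t_coverP => B; apply: intF.
have [T [covT le_TA minT]] := exists_min_cover covA; rewrite (cardF FA) in le_TA.
exists T => //; have gt_tT := t_cover_card_gt le_tV nontriv covT.
apply/eqP; rewrite eqn_leq addn1 gt_tT andbT leqNgt; apply/negP => T_big.
have := card_min_cover cardF intF (leq_trans (leq_addr _ _) le_tk) covT minT.
have [m eT] : exists m, #|T| = t + m by exists (#|T| - t); set_lia.
rewrite card_ord eT addKn !subnDA.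
have m_gt1 : 1 < m by set_lia.
have le_ms : m <= k - t by set_lia.
have := cover_bound s_gt1 t_gt0 def_c def_q le_qN le_sN m_gt1 le_ms.
have := sizeF_gap (leq0n _) (gap_no_cover s_gt1 t_gt0 def_c def_q le_qN le_sN).
rewrite (_ : 'C(t + 2, t) = 'C(t + 2, 2)); last first.
  by rewrite -bin_sub ?leq_addr // addKn.
rewrite mul0n add0n -!mulnA => lt1 le2 le3.
by have := leq_trans lt1 (leq_trans le3 le2); rewrite ltnn.
Qed.

Lemma exists_other_cover (T : {set 'I_n}) : #|T| = t + 1 -> t_cover t F T ->
  exists U : {set 'I_n}, [/\ #|U| = t + 1, t_cover t F U & U != T].
Proof.
move=> cT covT.
case: (boolP [exists U : {set 'I_n}, [&& #|U| == t + 1, t_cover t F U & U != T]]).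
  by case/existsP => U /and3P[/eqP cU covU neq]; exists U.
move/existsPn => uniq.
have uniqT (U : {set 'I_n}) : #|U| = t + 1 -> t_cover t F U -> U = T.
  by move=> cU covU; have := uniq U; rewrite cU eqxx covU /= negbK => /eqP.
have := card_unique_cover cardF intF (leq_trans (leq_addr _ _) le_tk) cT covT uniqT nontriv.
have := sizeF_gap (ltnW s_gt1) (gap_unique_cover s_gt1 t_gt0 def_c def_q le_qN le_sN).
rewrite card_ord mul1n -!mulnA => lt1 le2.
by have := leq_trans lt1 le2; rewrite ltnn.
Qed.

Lemma star_of_covers (X : {set 'I_n}) : #|X| = t ->
    (forall U : {set 'I_n}, #|U| = t + 1 -> t_cover t F U -> X \subset U) ->
    1 < #|cover_ext t F X| ->
  exists (c : nat) (M C : {set 'I_n}),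
     [/\ (k + 1 <= c <= 2 * k - t) \/ c = n, #|M| = k /\ #|C| = c,
         X \subset M, M \subset C & F = H1 k t c X M C].
Proof.
move=> cX starX L_gt1; set L := cover_ext t F X in L_gt1.
have le_tk' : t <= k by lia.
case: (leqP (k - t) #|L|) => [le_sL | lt_Ls].
  have [U UL cU] := exists_subset_card le_sL.
  have XU : X :&: U = set0.
    apply/setP => x; rewrite !inE; case Ux: (x \in U); rewrite ?andbF // andbT.
    by have := subsetP UL x Ux; rewrite inE => /andP[/negPf].
  have cM : #|X :|: U| = k by have := cardsUI X U; rewrite XU cards0; set_lia.
  have [|c [C [hc cC MC eF]]] :=
      H1_of_covers cardF intF maxF t_gt0 le_tk cX cM (subsetUl _ _) _ (nontriv cX).
    move=> x; rewrite !inE => /andP[/negPf -> /= /(subsetP UL)].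
    by rewrite inE => /andP[].
  by exists c, (X :|: U), C; split=> //; apply: subsetUl.
exfalso; case: (eqVneq #|L| 2) => [cL | neqL2].
  have := card_two_covers cardF intF le_tk' cX (nontriv cX) starX cL.
  rewrite cL in lt_Ls.
  have := sizeF_gap (ltnW lt_Ls) (gap_two_covers s_gt1 t_gt0 def_c def_q le_qN le_sN lt_Ls).
  by rewrite card_ord => lt1 le2; have := leq_trans lt1 le2; rewrite ltnn.
have L_gt2 : 2 < #|L| by rewrite ltn_neqAle eq_sym neqL2.
have := card_many_covers cardF intF le_tk' cX (nontriv cX) L_gt2.
have L_bounds : 2 < #|L| < k - t by rewrite L_gt2.
have := sizeF_gap (ltnW lt_Ls) (gap_many_covers s_gt1 t_gt0 def_c def_q le_qN le_sN L_bounds).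
by rewrite card_ord => lt1 le2; have := leq_trans lt1 le2; rewrite ltnn.
Qed.

Lemma large_family_structure :
  (exists (c : nat) (X M C : {set 'I_n}),
     [/\ (k + 1 <= c <= 2 * k - t) \/ c = n,
         [/\ #|X| = t, #|M| = k & #|C| = c],
         X \subset M, M \subset C & F = H1 k t c X M C])
  \/ (exists Z : {set 'I_n}, #|Z| = t + 2 /\ F = H2 k t Z) /\ k - t <= t + 2.
Proof.
have [T1 c1 cov1] := exists_succ_cover.
have [T2 [c2 cov2 neq12]] := exists_other_cover c1 cov1.
have meet (T U : {set 'I_n}) : #|T| = t + 1 -> #|U| = t + 1 -> t_cover t F T ->
    t_cover t F U -> t <= #|T :&: U|.
  by move=> cT cU covT covU; apply: (t_cover_meet maxF _ _ covT covU); rewrite ?card_ord; set_lia.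
have c12 : #|T1 :&: T2| = t.
  suff : #|T1 :&: T2| < #|T1| by have := meet _ _ c1 c2 cov1 cov2; set_lia.
  rewrite proper_card // properEneq subsetIl andbT; apply: contra neq12 => /eqP/setIidPl s12.
  by rewrite eq_sym eqEcard s12 c1 c2 /=.
case: (boolP [forall U : {set 'I_n},
         (#|U| == t + 1) && t_cover t F U ==> (T1 :&: T2 \subset U)]).
  move/forallP => starX; left.
  have [||c [M [C [hc [cM cC] XM MC eF]]]] := @star_of_covers (T1 :&: T2) c12.
  - by move=> U cU covU; have := starX U; rewrite cU eqxx covU.
  (* The points of [T1 :\: T2] and [T2 :\: T1] extend [T1 :&: T2] to the two covers, so [cover_ext]
     has at least two points. *)
  - have del (T U : {set 'I_n}) : #|T| = t + 1 -> t_cover t F T -> #|T :&: U| = t ->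
        exists2 x, x \in T :\: U & x \in cover_ext t F (T :&: U).
      move=> cT covT cTU; have : 0 < #|T :\: U| by have := cardsID U T; set_lia.
      case/card_gt0P => x; rewrite inE => /andP[xU xT].
      exists x; first by rewrite inE xU xT.
      rewrite !inE (negPf xU) andbF /=.
      suff -> : x |: T :&: U = T by [].
      apply/eqP; rewrite eqEcard subUset sub1set xT subsetIl cardsU1 inE (negPf xU) andbF.
      by set_lia.
    have [x x1 Lx] := del T1 T2 c1 cov1 c12.
    have [|y y1] := del T2 T1 c2 cov2; rewrite setIC // => Ly.
    apply/card_gt1P; exists x, y; split=> //.
    by apply: contraTneq x1 => ->; move: y1; rewrite !inE => /andP[_ ->].
  by exists c, (T1 :&: T2), M, C; split.
rewrite negb_forall => /existsP[T3]; rewrite negb_imply -andbA => /and3P[/eqP c3 cov3 n3].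
have [x [y [z [cZ memZ neqZ [e1 e2 e3]]]]] :=
  covers_triangle (And3 c1 c2 c3) c12 (meet _ _ c3 c1 cov3 cov1) (meet _ _ c3 c2 cov3 cov2) n3.
right; set Z := T1 :|: T2 in cZ memZ e1 e2 e3.
have eF : F = H2 k t Z.
  by apply: (H2_of_triangle cardF maxF t_gt0 cZ memZ neqZ); rewrite -e1 -e2 -e3.
split; first by exists Z.
rewrite leqNgt; apply/negP => lt_ts.
have FZ A : A \in F -> t + 1 <= #|A :&: Z| by rewrite {1}eF inE => /andP[].
have := card_le_H2 cardF cZ FZ.
have := sizeF_gap (ltnW lt_ts) (gap_H2 s_gt1 t_gt0 def_c def_q le_qN le_sN lt_ts).
rewrite card_ord mul0n addn0 => lt1 le2.
by have := leq_trans lt1 le2; rewrite ltnn.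
Qed.

End LargeFamilies.

(** * Passage from the stated hypotheses to natural-number inequalities *)

Theorem theorem1p1 (n k t : nat) (F : {set {set 'I_n}})
  (ht : 1 <= t <= k - 2)
  (hn : (Num.max ('C(t + 2, 2)%:R : rat) ((k - t + 2)%:R / 2%:R)
           * ((k - t + 1)%:R) ^+ 2 + t%:R <= n%:R)%R)
  (hF : F \subset ksubsets n k)
  (hmax : maximal_t_intersecting k t F)
  (hnontriv : ~~ trivial_family t F)
  (hsize : (((k - t) * 'C(n - t - 1, k - t - 1))%:Z
            - ('C(k - t, 2) * 'C(n - t - 2, k - t - 2))%:Z
            <= #|F|%:Z)%R) :
  (exists (c : nat) (X M C : {set 'I_n}),
     [/\ (k + 1 <= c <= 2 * k - t) \/ c = n,
         [/\ #|X| = t, #|M| = k & #|C| = c],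
         X \subset M, M \subset C & F = H1 k t c X M C])
  \/
  (exists Z : {set 'I_n}, #|Z| = t + 2 /\ F = H2 k t Z)
    /\ (k%:R / 2%:R - 1 <= t%:R :> rat)%R /\ t <= k - 2.
Proof.
have /andP[t_gt0 le_tk2] := ht.
have le_tk : t + 2 <= k by lia.
have cardF A : A \in F -> #|A| = k by move/(subsetP hF); rewrite inE => /eqP.
have /maxsetP[/andP[_ /forall_inP intF'] maxF'] := hmax.
have intF A B : A \in F -> B \in F -> t <= #|A :&: B|.
  by move=> FA FB; have /forall_inP := intF' A FA; apply.
have maxF (A : {set 'I_n}) : #|A| = k ->
    (forall B, B \in F -> t <= #|A :&: B|) -> A \in F.
  (* [A |: F] is still [t]-intersecting, so maximality identifies it with [F]. *)
  move=> cA meetA; rewrite -(maxF' (A |: F)) ?setU11 ?subsetUr //.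
  rewrite subUset sub1set hF inE cA eqxx /=.
  apply/forall_inP => B /setU1P[->|FB]; apply/forall_inP => C /setU1P[->|FC].
  - by rewrite setIid cA; lia.
  - exact: meetA.
  - by rewrite setIC; apply: meetA.
  - exact: intF.
have nontriv (X : {set 'I_n}) : #|X| = t -> exists2 A, A \in F & ~~ (X \subset A).
  move=> cX; apply/exists_inP; rewrite -negb_forall_in.
  by apply: contra hnontriv => XF; apply/existsP; exists X; rewrite cX eqxx.
have sqr_ge0 : (0 <= (k - t + 1)%:R ^+ 2 :> rat)%R by rewrite exprn_ge0.
have le_qn : 'C(t + 2, 2) * (k - t + 1) ^ 2 + t <= n.
  rewrite -(ler_nat rat) natrD natrM natrX; apply: le_trans hn.
  by rewrite lerD2r ler_wpM2r // le_max lexx.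
have le_sn : (k - t + 2) * (k - t + 1) ^ 2 + 2 * t <= 2 * n.
  rewrite -(ler_nat rat) natrD natrM natrX (natrM _ 2 t) (natrM _ 2 n).
  have : ((k - t + 2)%:R / 2%:R * (k - t + 1)%:R ^+ 2 + t%:R <= n%:R :> rat)%R.
    by apply: le_trans hn; rewrite lerD2r ler_wpM2r // le_max lexx orbT.
  lra.
have sizeF : (k - t) * 'C(n - t - 1, k - t - 1)
  <= #|F| + 'C(k - t, 2) * 'C(n - t - 2, k - t - 2) by lia.
have [H1F|[H2F le_st]] :=
  large_family_structure t_gt0 le_tk le_qn le_sn cardF intF maxF nontriv sizeF.
  by left.
right; split=> //; split=> //.
(* [k - t <= t + 2] is the bound [k / 2 - 1 <= t] with denominators cleared. *)
have : (k%:R <= (2 * t + 2)%:R :> rat)%R by rewrite ler_nat; lia.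
rewrite natrD natrM; lra.
Qed.
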